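(* Let $k$ be a field with $\operatorname{char} k\neq 2$, let $\alpha,\beta\in k$ with either $\alpha\beta\neq 0$ or $\alpha=\beta=0$, and let $L$ be a Lie algebra over $k$ with a basis $\{e_1,e_2,e_3\}$ such that $$[e_1,e_2]=e_3,\quad [e_2,e_3]=\alpha e_1,\quad [e_3,e_1]=\beta e_2 .$$ Let $p,u,s\in k$ and $$r=p(e_1\otimes e_2)-p(e_2\otimes e_1)+s(e_1\otimes e_3)-s(e_3\otimes e_1)+u(e_2\otimes e_3)-u(e_3\otimes e_2).$$ Then: (I) $(L,[\ ],\Delta_r,r)$ is a coboundary Lie bialgebra if and only if $r$ is skew symmetric; (II) $(L,[\ ],\Delta_r,r)$ is a triangular Lie bialgebra if and only if $\beta s^2+\alpha u^2+p^2=0$.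
   Context: Let $L$ be a Lie algebra over $k$. For $r=\sum_i a_i\otimes b_i\in L\otimes L$ and $x\in L$ put $x\cdot r=\sum_i([x,a_i]\otimes b_i+a_i\otimes[x,b_i])$ and $\Delta_r(x)=x\cdot r$. The element $r$ is a solution of the classical Yang–Baxter equation (CYBE) if $[r^{12},r^{13}]+[r^{12},r^{23}]+[r^{13},r^{23}]=0$ in $L\otimes L\otimes L$, where $[r^{12},r^{13}]=\sum_{i,j}[a_i,a_j]\otimes b_i\otimes b_j$, $[r^{12},r^{23}]=\sum_{i,j}a_i\otimes[b_i,a_j]\otimes b_j$, $[r^{13},r^{23}]=\sum_{i,j}a_i\otimes a_j\otimes[b_i,b_j]$. An element $r=\sum k_{ij}(e_i\otimes e_j)$ is skew symmetric if $k_{ij}=-k_{ji}$ for all $i,j$. Let $\tau(x\otimes y)=y\otimes x$ on $L\otimes L$ and $\xi(x\otimes y\otimes z)=y\otimes z\otimes x$ on $L\otimes L\otimes L$. A vector space $L$ with a linear map $\Delta:L\to L\otimes L$ is a Lie coalgebra if (i) $\operatorname{Im}\Delta\subseteq\operatorname{Im}(1-\tau)$ and (ii) $(1+\xi+\xi^2)(1\otimes\Delta)\Delta=0$. $(L,[\ ],\Delta)$ is a Lie bialgebra if $(L,[\ ])$ is a Lie algebra, $(L,\Delta)$ is a Lie coalgebra, and $\Delta[x,y]=x\cdot\Delta(y)-y\cdot\Delta(x)$ for all $x,y\in L$. $(L,[\ ],\Delta,r)$ is a coboundary Lie bialgebra if $(L,[\ ],\Delta)$ is a Lie bialgebra, $r\in\operatorname{Im}(1-\tau)\subseteq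 L\otimes L$, and $\Delta(x)=x\cdot r$ for all $x\in L$. A coboundary Lie bialgebra $(L,[\ ],\Delta,r)$ is triangular if $r$ is a solution of the CYBE. *)

(* Defs.v *)
From mathcomp Require Import all_boot all_algebra.

Set Implicit Arguments.
Unset Strict Implicit.
Unset Printing Implicit Defensive.

Import GRing.Theory.
Local Open Scope ring_scope.

Notation bilinear f := (bilinear_for *:%R *:%R f).

(* The tensor product of two finite-dimensional spaces is realised by matrices
   of coordinates; [tens_bilinear], [tlift_is_linear], [tlift_tens] and
   [tlift_uniq] state its universal property. *)
Definition tensor (k : fieldType) (U V : vectType k) : vectType k :=
  'M[k]_(\dim {:U}, \dim {:V}).

Definition tens (k : fieldType) (U V : vectType k) (u : U) (v : V) :
    tensor U V :=
  \matrix_(i, j) (coord (vbasis {:U}) i u * coord (vbasis {:V}) j v).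

Notation "u ⊗ v" := (tens u v) (at level 35, right associativity) : ring_scope.

(* The linear map on [tensor U V] sending [u ⊗ v] to [f u v], for [f] bilinear. *)
Definition tlift (k : fieldType) (U V W : vectType k) (f : U -> V -> W)
    (t : tensor U V) : W :=
  \sum_i \sum_j (t : 'M_(_, _)) i j *: f (vbasis {:U})`_i (vbasis {:V})`_j.

Section TensorTheory.

Variables (k : fieldType) (U V W : vectType k).

Lemma tens_bilinear : bilinear (@tens k U V).
Proof.
split=> [v a u u' | u a v v']; apply/matrixP=> i j; rewrite !mxE linearP /=.
  by rewrite mulrDl mulrA.
by rewrite mulrDr mulrCA.
Qed.

Lemma tlift_is_linear (f : U -> V -> W) : linear (tlift f).
Proof.
move=> a s t; rewrite /tlift scaler_sumr -big_split; apply: eq_bigr => i _ /=.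
rewrite scaler_sumr -big_split; apply: eq_bigr => j _ /=.
by rewrite !mxE scalerDl scalerA.
Qed.

Lemma tlift_tens (f : U -> V -> W) (u : U) (v : V) :
  bilinear f -> tlift f (u ⊗ v) = f u v.
Proof.
case=> fl fr.
have suml (I : finType) (c : I -> k) (F : I -> U) w :
  f (\sum_i c i *: F i) w = \sum_i c i *: f (F i) w.
  have f0 : f 0 w = 0.
    by have := fl w (-1) 0 0; rewrite scaler0 addr0 /= scaleN1r addNr.
  apply: (big_rec2 (fun x y => f x w = y)) => // i x y _ <-.
  by have := fl w (c i) (F i) x.
have sumr (I : finType) (c : I -> k) (F : I -> V) w :
  f w (\sum_i c i *: F i) = \sum_i c i *: f w (F i).
  have f0 : f w 0 = 0.
    by have := fr w (-1) 0 0; rewrite scaler0 addr0 /= scaleN1r addNr.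
  apply: (big_rec2 (fun x y => f w x = y)) => // i x y _ <-.
  by have := fr w (c i) (F i) x.
rewrite [in RHS](coord_vbasis (memvf u)) suml; apply: eq_bigr => i _.
rewrite [in RHS](coord_vbasis (memvf v)) sumr scaler_sumr; apply: eq_bigr => j _.
by rewrite scalerA mxE.
Qed.

Lemma tens_span (t : tensor U V) :
  t = \sum_i \sum_j (t : 'M_(_, _)) i j *: ((vbasis {:U})`_i ⊗ (vbasis {:V})`_j).
Proof.
have fU := basis_free (vbasisP {:U}); have fV := basis_free (vbasisP {:V}).
rewrite {1}[t]matrix_sum_delta; apply: eq_bigr => i _.
apply: eq_bigr => j _; congr (_ *: _); apply/matrixP=> i' j'.
by rewrite !mxE !coord_free // -natrM mulnb (eq_sym i) (eq_sym j).
Qed.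

Lemma tlift_uniq (f : U -> V -> W) (g : {linear tensor U V -> W}) :
  (forall u v, g (u ⊗ v) = f u v) -> g =1 tlift f.
Proof.
move=> gf t; rewrite {1}(tens_span t) linear_sum; apply: eq_bigr => i _.
by rewrite linear_sum; apply: eq_bigr => j _; rewrite linearZ /= gf.
Qed.

End TensorTheory.

Section TensorMaps.

Variables (k : fieldType) (L : vectType k).

Definition tau : tensor L L -> tensor L L := tlift (fun x y => y ⊗ x).

(* L ⊗ L ⊗ L is bracketed to the right throughout. *)
Definition xi : tensor L (tensor L L) -> tensor L (tensor L L) :=
  tlift (fun x => tlift (fun y z => y ⊗ z ⊗ x)).

Definition id_tens (D : L -> tensor L L) :
  tensor L L -> tensor L (tensor L L) := tlift (fun x y => x ⊗ D y).

Definition in_im_one_sub_tau (t : tensor L L) : Prop :=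
  exists s : tensor L L, t = s - tau s.

Definition skew_symmetric (n : nat) (e : n.-tuple L) (r : tensor L L) : Prop :=
  exists2 K : 'M[k]_n,
    r = \sum_i \sum_j K i j *: (tnth e i ⊗ tnth e j)
    & forall i j, K i j = - K j i.

End TensorMaps.

Record lie_algebra (k : fieldType) (L : lmodType k) (br : L -> L -> L) : Prop :=
  LieAlgebra {
    lie_bilinear : bilinear br;
    lie_alternating : forall x, br x x = 0;
    lie_jacobi : forall x y z,
      br x (br y z) + br y (br z x) + br z (br x y) = 0 }.

Record lie_coalgebra (k : fieldType) (L : vectType k) (D : L -> tensor L L) :
    Prop :=
  LieCoalgebra {
    colie_linear : linear D;
    colie_skew : forall x, in_im_one_sub_tau (D x);
    colie_jacobi : forall x,
      let t := id_tens D (D x) in t + xi t + xi (xi t) = 0 }.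

Section LieBialgebra.

Variables (k : fieldType) (L : vectType k) (br : L -> L -> L).

Definition lie_act (x : L) : tensor L L -> tensor L L :=
  tlift (fun a b => br x a ⊗ b + a ⊗ br x b).

Definition cobracket (r : tensor L L) (x : L) : tensor L L := lie_act x r.

Record lie_bialgebra (D : L -> tensor L L) : Prop := LieBialgebra {
  bialg_algebra : lie_algebra br;
  bialg_coalgebra : lie_coalgebra D;
  bialg_cocycle : forall x y, D (br x y) = lie_act x (D y) - lie_act y (D x) }.

Record coboundary_lie_bialgebra (D : L -> tensor L L) (r : tensor L L) : Prop :=
  CoboundaryLieBialgebra {
    cobound_bialgebra : lie_bialgebra D;
    cobound_skew : in_im_one_sub_tau r;
    cobound_eq : forall x, D x = lie_act x r }.

(* In the next three definitions [a ⊗ b] runs over the terms of the first copy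
   of [r] and [c ⊗ d] over those of the second. *)
Definition br12_13 (r : tensor L L) : tensor L (tensor L L) :=
  tlift (fun a b => tlift (fun c d => br a c ⊗ b ⊗ d) r) r.

Definition br12_23 (r : tensor L L) : tensor L (tensor L L) :=
  tlift (fun a b => tlift (fun c d => a ⊗ br b c ⊗ d) r) r.

Definition br13_23 (r : tensor L L) : tensor L (tensor L L) :=
  tlift (fun a b => tlift (fun c d => a ⊗ c ⊗ br b d) r) r.

Definition cybe (r : tensor L L) : Prop :=
  br12_13 r + br12_23 r + br13_23 r = 0.

Definition triangular_lie_bialgebra (D : L -> tensor L L) (r : tensor L L) :
  Prop := coboundary_lie_bialgebra D r /\ cybe r.

End LieBialgebra.

(* Main.v *)
From HB Require Import structures.
Require Import Defs.
From mathcomp Require Import all_boot all_algebra.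
From mathcomp Require Import ring.

(** Write [x ∧ y] for [x ⊗ y - y ⊗ x].  The bracket sends the bivector [r] to
    [w = p [e1, e2] + s [e1, e3] + u [e2, e3] = α u e1 - β s e2 + p e3], and the
    proof rests on the fact that in these algebras
<<
    x · r = x ∧ w        for all x                      (cobracket_wedge).
>>
    A cobracket of this shape is automatically co-Jacobi: since [w · r = 0], one
    gets [(1 ⊗ Δ)(x ∧ w) = w ⊗ w ⊗ x - w ⊗ x ⊗ w], a difference of two tensors in
    the same orbit of the cyclic permutation [ξ].  Moreover [x ∧ w] is skew, and
    the cocycle identity holds for [x · r] with any [r], being the statement that
    [L] acts on [L ⊗ L] ([lie_act_br]).  Hence every skew [r] with the displayed
    property gives a coboundary Lie bialgebra ([coboundary_of_wedge]).  As the [r] of the theorem is skew by its very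
    form, both sides of (I) always hold, and (II) only concerns the CYBE.

    For the CYBE, the last two of its three terms add up to [(1 ⊗ Δ_r) r], which
    the same formula turns into [∑ a_i ⊗ (b_i ∧ w)], while the first one is
    [w ⊗ r] ([br12_13_wedge]).  Their sum is totally antisymmetric, so in
    dimension three it is a multiple of the volume element; the multiple is the
    pairing of [w] with [r], namely [β s² + α u² + p²] ([cybeE]).  The volume
    element is not zero ([volume_neq0]), so this scalar decides the CYBE. *)

Import GRing.Theory.
Local Open Scope ring_scope.

(** * Linear and bilinear structure of tensors *)

Section Tensors.

Set Implicit Arguments.
Unset Strict Implicit.

Variables (k : fieldType) (U V W : vectType k).
Implicit Types (t : tensor U V).

HB.instance Definition _ (f : U -> V -> W) :=
  GRing.isLinear.Build k (tensor U V) W *:%R (tlift f) (tlift_is_linear f).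

HB.instance Definition _ :=
  bilinear_isBilinear.Build k U V (tensor U V) *:%R *:%R
    (@tens k U V) (@tens_bilinear k U V).

(** [linear_tlift] takes a bundled linear map, and [tens u] must qualify as one
    when it is not applied to a second argument. *)
HB.instance Definition _ (u : U) := GRing.isLinear.Build k V (tensor U V) *:%R
  (tens u) ((@tens_bilinear k U V).2 u).

Lemma tensor_ind (P : tensor U V -> Prop) :
    (forall u v, P (u ⊗ v)) -> P 0 ->
    (forall a t1 t2, P t1 -> P t2 -> P (a *: t1 + t2)) ->
  forall t, P t.
Proof.
move=> Pt P0 Pl t; rewrite (tens_span t).
have PD t1 t2 : P t1 -> P t2 -> P (t1 + t2).
  by move=> P1 P2; rewrite -[t1]scale1r; apply: Pl.
elim/big_ind: _ => // i _; elim/big_ind: _ => // j _.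
by rewrite -[X in P X]addr0; apply: Pl.
Qed.

Lemma linear_tlift (W' : vectType k) (g : {linear W -> W'}) (f : U -> V -> W) t :
  g (tlift f t) = tlift (fun u v => g (f u v)) t.
Proof.
rewrite linear_sum; apply: eq_bigr => i _; rewrite linear_sum.
by apply: eq_bigr => j _; rewrite linearZ.
Qed.

(** Linearity of the lift in the bilinear map instead of the tensor, as needed to
    evaluate nested lifts one variable at a time. *)
Lemma tliftP a (f g : U -> V -> W) t :
  tlift (fun u v => a *: f u v + g u v) t = a *: tlift f t + tlift g t.
Proof.
rewrite scaler_sumr -big_split; apply: eq_bigr => i _ /=.
rewrite scaler_sumr -big_split; apply: eq_bigr => j _ /=.
by rewrite scalerDr !scalerA mulrC.
Qed.

Lemma eq_tlift (f g : U -> V -> W) t :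
  (forall u v, f u v = g u v) -> tlift f t = tlift g t.
Proof.
move=> fg; apply: eq_bigr => i _; apply: eq_bigr => j _; by rewrite fg.
Qed.

End Tensors.

(** * Maps between tensor powers *)

Section TensorMaps.

Set Implicit Arguments.
Unset Strict Implicit.

Variables (k : fieldType) (L : vectType k).
Implicit Types (x y z : L) (t : tensor L L).

HB.instance Definition _ := GRing.Linear.copy (@tau k L) (tlift (fun x y => y ⊗ x)).
HB.instance Definition _ := GRing.Linear.copy (@xi k L)
  (tlift (fun x => tlift (fun y z => y ⊗ z ⊗ x))).
HB.instance Definition _ (D : L -> tensor L L) :=
  GRing.Linear.copy (id_tens D) (tlift (fun x y => x ⊗ D y)).
HB.instance Definition _ (br : L -> L -> L) x :=
  GRing.Linear.copy (lie_act br x) (tlift (fun a b => br x a ⊗ b + a ⊗ br x b)).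

Definition wedge x y : tensor L L := x ⊗ y - y ⊗ x.

Definition volume x y z : tensor L (tensor L L) :=
  x ⊗ wedge y z + y ⊗ wedge z x + z ⊗ wedge x y.

Lemma tau_tens x y : tau (x ⊗ y) = y ⊗ x.
Proof.
rewrite /tau tlift_tens //; split=> [v a u u' | u a v v'] /=.
  exact: linearPr.
exact: linearPl.
Qed.

Lemma xi_tens x y z : xi (x ⊗ y ⊗ z) = y ⊗ z ⊗ x.
Proof.
have bil v : Defs.bilinear (fun y z : L => y ⊗ z ⊗ v).
  split=> [w a u u' | w a u u'] /=; first exact: linearPl.
  by rewrite linearPl linearPr.
rewrite /xi !tlift_tens //; split=> [t a u u' | u a t t'] /=; last exact: linearP.
rewrite -tliftP; apply: eq_tlift => v w; by rewrite !linearPr.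
Qed.

Lemma id_tens_tens (D : L -> tensor L L) x y :
  linear D -> id_tens D (x ⊗ y) = x ⊗ D y.
Proof.
move=> linD; rewrite /id_tens tlift_tens //.
split=> [v a u u' | u a v v'] /=; first exact: linearPl.
by rewrite linD linearPr.
Qed.

Lemma im_one_sub_tau_linear a t1 t2 :
  in_im_one_sub_tau t1 -> in_im_one_sub_tau t2 -> in_im_one_sub_tau (a *: t1 + t2).
Proof.
move=> [s1 ->] [s2 ->]; exists (a *: s1 + s2).
by rewrite linearP scalerBr opprD addrACA.
Qed.

Lemma im_one_sub_tau_wedge x y : in_im_one_sub_tau (wedge x y).
Proof. by exists (x ⊗ y); rewrite tau_tens. Qed.

End TensorMaps.

(** * Lie algebras *)

Section Bracket.

Set Implicit Arguments.
Unset Strict Implicit.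

Variables (k : fieldType) (L : vectType k) (br : L -> L -> L).
Hypothesis br_lie : lie_algebra br.
Implicit Types (x y z : L) (t : tensor L L).

Let brPl z a x y : br (a *: x + y) z = a *: br x z + br y z.
Proof. by have [[+ _] _ _] := br_lie; apply. Qed.
Let brPr z a x y : br z (a *: x + y) = a *: br z x + br z y.
Proof. by have [[_ +] _ _] := br_lie; apply. Qed.

Lemma lie_antisym x y : br x y = - br y x.
Proof.
have [_ alt _] := br_lie; have := alt (1 *: x + y).
rewrite brPl !brPr !alt !scale1r add0r addr0 addrC.
by move/eqP; rewrite addr_eq0 => /eqP ->; rewrite opprK.
Qed.

Lemma lie_act_tens x a b : lie_act br x (a ⊗ b) = br x a ⊗ b + a ⊗ br x b.
Proof.
rewrite /lie_act tlift_tens //; split=> [v c u u' | u c v v'] /=.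
  by rewrite brPr !linearPl scalerDr addrACA.
by rewrite brPr !linearPr scalerDr addrACA.
Qed.

(** [L] acts on [L ⊗ L]: on pure tensors this is the Jacobi identity in each
    factor, the mixed terms cancelling in the commutator. *)
Lemma lie_act_br x y t :
  lie_act br (br x y) t = lie_act br x (lie_act br y t) - lie_act br y (lie_act br x t).
Proof.
have br0 z : br z 0 = 0 by have := brPr z (-1) 0 0; rewrite !scaleN1r !addNr.
have brN z v : br z (- v) = - br z v.
  by have := brPr z (-1) v 0; rewrite !scaleN1r br0 !addr0.
have jac z : br (br x y) z = br x (br y z) - br y (br x z).
  have [_ _ /(_ x y z) J] := br_lie.
  rewrite [LHS]lie_antisym (lie_antisym x z) brN opprK.
  by apply/esym/eqP; rewrite -subr_eq0 opprK J.
elim/tensor_ind: t => [a b||a t1 t2 IH1 IH2]; last 2 first.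
- by rewrite !linear0 addr0.
- by rewrite !linearP /= IH1 IH2 scalerDr addrACA.
rewrite !lie_act_tens !linearD /= !lie_act_tens !jac linearBl linearBr /=.
apply/matrixP=> i j; rewrite !mxE; ring.
Qed.

Lemma lie_act_linear t : linear (fun x => lie_act br x t).
Proof.
move=> a x y; rewrite /lie_act -tliftP; apply: eq_tlift => u v.
by rewrite !brPl linearPl linearPr scalerDr addrACA.
Qed.

Lemma br12_13_tens t (a b : L) :
  tlift (fun a b : L => tlift (fun c d : L => br a c ⊗ b ⊗ d) t) (a ⊗ b)
    = tlift (fun c d : L => br a c ⊗ b ⊗ d) t.
Proof.
rewrite tlift_tens //; split=> [v c u u' | u c v v'] /=;
  rewrite -tliftP; apply: eq_tlift => x y; first by rewrite brPl linearPl.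
by rewrite linearPl linearPr.
Qed.

Lemma br12_13_tens_tens (a b c d : L) :
  tlift (fun c d : L => br a c ⊗ b ⊗ d) (c ⊗ d) = br a c ⊗ b ⊗ d.
Proof.
rewrite tlift_tens //; split=> [v e u u' | u e v v'] /=.
  by rewrite brPr linearPl.
by rewrite !linearPr.
Qed.

(** Fixing the term [a ⊗ b] of the first copy of [t], the two summands
    [a ⊗ [b, c] ⊗ d] and [a ⊗ c ⊗ [b, d]] make up [a ⊗ (b · t)]. *)
Lemma br23_cobracket t : br12_23 br t + br13_23 br t = id_tens (cobracket br t) t.
Proof.
rewrite -[br12_23 br t]scale1r -tliftP; apply: eq_tlift => a b.
rewrite -tliftP /cobracket /lie_act (linear_tlift (@tens k L (tensor L L) a)).
apply: eq_tlift => c d.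
by rewrite scale1r linearD.
Qed.

(** The co-Jacobi identity comes for free: [Δ w = w ∧ w = 0], so only
    [- w ⊗ Δ x] is left of [(1 ⊗ Δ)(x ∧ w)], and its two terms are cyclic
    permutations of each other, hence have the same cyclic sum. *)
Lemma coboundary_of_wedge t w :
    in_im_one_sub_tau t -> (forall x, cobracket br t x = wedge x w) ->
  coboundary_lie_bialgebra br (cobracket br t) t.
Proof.
move=> skew_t Dw; split=> //; split=> //; last by move=> x y; exact: lie_act_br.
have linD : linear (cobracket br t) := lie_act_linear t.
split=> // [x | x /=]; first by rewrite Dw; exact: im_one_sub_tau_wedge.
have -> : id_tens (cobracket br t) (cobracket br t x) = w ⊗ w ⊗ x - w ⊗ x ⊗ w.
  rewrite Dw linearB /= !id_tens_tens // !Dw /wedge subrr linear0r sub0r.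
  by rewrite linearBr opprB.
rewrite !linearB /= !xi_tens.
apply/matrixP=> i j; rewrite !mxE; ring.
Qed.

End Bracket.

Section Coordinates.

Set Implicit Arguments.
Unset Strict Implicit.

Variables (k : fieldType) (V : vectType k) (n : nat) (X : n.-tuple V).
Implicit Types (i : 'I_n) (a : k) (v : V).

Lemma coordZ i a v :
  coord X i (a *: v) = a * coord X i v.
Proof. exact: linearZ. Qed.
Lemma coordD i v v' :
  coord X i (v + v') = coord X i v + coord X i v'.
Proof. exact: linearD. Qed.
Lemma coordN i v : coord X i (- v) = - coord X i v.
Proof. exact: linearN. Qed.
Lemma coord0 i : coord X i 0 = 0.
Proof. exact: linear0. Qed.

End Coordinates.

Definition coordE := (coordD, coordN, coordZ, coord0).

(** * Three-dimensional algebras *)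

Section CyclicBrackets.

Set Implicit Arguments.
Unset Strict Implicit.

Variables (k : fieldType) (L : vectType k) (br : L -> L -> L).
Hypothesis br_lie : lie_algebra br.
Variables (alpha beta : k) (e1 e2 e3 : L).
Hypothesis e_basis : basis_of fullv [:: e1; e2; e3].
Hypotheses (br12 : br e1 e2 = e3) (br23 : br e2 e3 = alpha *: e1).
Hypothesis br31 : br e3 e1 = beta *: e2.
Variables p u s : k.

Variables (r : tensor L L) (w : L).
Hypothesis rE : r = p *: wedge e1 e2 + s *: wedge e1 e3 + u *: wedge e2 e3.
Hypothesis wE : w = (alpha * u) *: e1 - (beta * s) *: e2 + p *: e3.

Let br21 : br e2 e1 = (-1) *: e3.
Proof. by rewrite lie_antisym ?br12 ?scaleN1r. Qed.
Let br32 : br e3 e2 = - alpha *: e1.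
Proof. by rewrite lie_antisym ?br23 ?scaleNr. Qed.
Let br13 : br e1 e3 = - beta *: e2.
Proof. by rewrite lie_antisym ?br31 ?scaleNr. Qed.
Let br_self x : br x x = 0. Proof. by have [_ ->] := br_lie. Qed.
Let brE := (br12, br23, br31, br21, br32, br13, br_self).

Lemma linear_r (W : vectType k) (f : {linear tensor L L -> W}) :
  f r = p *: (f (e1 ⊗ e2) - f (e2 ⊗ e1)) + s *: (f (e1 ⊗ e3) - f (e3 ⊗ e1))
        + u *: (f (e2 ⊗ e3) - f (e3 ⊗ e2)).
Proof. by rewrite rE 2!(linearD f) 3!(linearZ_LR f) /= /wedge 3!(linearB f). Qed.

(** Both sides are linear in [x], so the basis suffices.  For instance [e1 · r] is
    [p (e1 ∧ e3) - β s (e1 ∧ e2)]: each [ad e_i] kills [e_i] and sends every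
    other basis vector to a multiple of the third, so no bivector without the
    factor [e_i] appears in [e_i · r]. *)
Lemma cobracket_wedge x : cobracket br r x = wedge x w.
Proof.
have step a y z : cobracket br r y = wedge y w -> cobracket br r z = wedge z w ->
    cobracket br r (a *: y + z) = wedge (a *: y + z) w.
  rewrite /cobracket (lie_act_linear br_lie) => -> ->.
  by rewrite /wedge linearPl linearPr scalerBr opprD addrACA.
rewrite (coord_basis (X := [tuple e1; e2; e3]) e_basis (memvf x)).
rewrite !big_ord_recl big_ord0 /=.
apply: (step); last (apply: (step); last apply: (step)); last first.
- have := lie_act_linear br_lie r (-1) 0 0; rewrite !scaleN1r !addNr => D0.
  by rewrite /cobracket D0 /wedge linear0l linear0r subrr.
all: rewrite /cobracket rE /wedge !(linearB, linearD, linearZ) /=.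
all: rewrite !lie_act_tens // !brE wE.
all: apply/matrixP=> i j; rewrite !mxE !coordE; ring.
Qed.

(** Write [r = ∑ e_i ⊗ f_i] with [f1 = p e2 + s e3], [f2 = u e3 - p e1] and
    [f3 = - s e1 - u e2].  The left side is
    [e3 ⊗ (f1 ∧ f2) + α e1 ⊗ (f2 ∧ f3) + β e2 ⊗ (f3 ∧ f1)], and the [f_i] span
    the support of [r], which has dimension at most two, so these bivectors are
    multiples of [r]: in order [p r], [u r] and [- s r].  The proof expands everything in coordinates. *)
Lemma br12_13_wedge : br12_13 br r = w ⊗ r.
Proof.
rewrite /br12_13 ![tlift _ _]linear_r /= !br12_13_tens //.
rewrite ![tlift _ r]linear_r /= !br12_13_tens_tens // !brE wE rE /wedge.
apply/matrixP=> i j; rewrite !mxE !coordE /=; ring.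
Qed.

(** After [w ⊗ r + ∑ a_i ⊗ (b_i ∧ w)] is expanded in the basis, the tensors with
    a repeated factor cancel; each of the other six carries, up to the sign of the
    permutation, the sum of the products of matching coefficients of [w] and
    [r]. *)
Lemma cybeE : br12_13 br r + br12_23 br r + br13_23 br r
  = (beta * s ^+ 2 + alpha * u ^+ 2 + p ^+ 2) *: volume e1 e2 e3.
Proof.
have id_r x y : id_tens (cobracket br r) (x ⊗ y) = x ⊗ wedge y w.
  rewrite id_tens_tens ?cobracket_wedge //; exact: (lie_act_linear br_lie).
have tens_w x : x ⊗ w = (alpha * u) *: x ⊗ e1 - (beta * s) *: x ⊗ e2 + p *: x ⊗ e3.
  by rewrite wE linearDr linearBr !linearZr_LR.
have w_tens x : w ⊗ x = (alpha * u) *: e1 ⊗ x - (beta * s) *: e2 ⊗ x + p *: e3 ⊗ x.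
  by rewrite wE linearDl linearBl !linearZl_LR.
rewrite -addrA (br23_cobracket br r) br12_13_wedge [id_tens _ r]linear_r /= !id_r.
rewrite rE /volume /wedge !tens_w !w_tens.
apply/matrixP=> i j; rewrite !mxE !coordE; ring.
Qed.

(** The product of the three coordinate forms takes the value 1 on [e1 ⊗ e2 ⊗ e3]
    and kills the other five terms of the volume element. *)
Lemma volume_neq0 : volume e1 e2 e3 != 0.
Proof.
pose c i : L -> k := coord [tuple e1; e2; e3] i.
have ce : free [tuple e1; e2; e3] := basis_free e_basis.
have cE i (j : 'I_3) : c i [tuple e1; e2; e3]`_j = (i == j)%:R.
  by rewrite /c coord_free // eq_sym.
have [phi phiE] : exists phi : {linear tensor L (tensor L L) -> k^o},
    forall x y z, phi (x ⊗ y ⊗ z) = c 0 x * c 1 y * c 2%:R z.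
  have bil v : Defs.bilinear (fun y z => c 0 v * c 1 y * c 2%:R z : k^o).
    split=> [t a y1 y2 | t a z1 z2] /=; rewrite /c linearP /=.
      by rewrite mulrDr mulrDl mulrCA -!mulrA.
    by rewrite mulrDr mulrCA.
  exists (tlift (fun x => tlift (fun y z => c 0 x * c 1 y * c 2%:R z : k^o))).
  move=> x y z /=; rewrite !tlift_tens //.
  split=> [t a x1 x2 | v a t1 t2] /=; last exact: linearP.
  rewrite -tliftP; apply: eq_tlift => y1 z1; rewrite /c linearP /=.
  by rewrite !mulrDl -!mulrA.
apply/eqP => vol0; have /eqP := congr1 phi vol0; rewrite /volume /wedge.
rewrite !linearBr !(linearD, linearN) /= !phiE linear0.
have ce1 i : c i e1 = (i == 0)%:R := cE i 0.
have ce2 i : c i e2 = (i == 1)%:R := cE i 1.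
have ce3 i : c i e3 = (i == 2%:R)%:R := cE i 2%:R.
rewrite !(ce1, ce2, ce3) /= !(mul0r, mulr0, mul1r, subr0, addr0).
by rewrite oner_eq0.
Qed.

End CyclicBrackets.

Theorem theorem2p1 (k : fieldType) (hk : 2%N \notin [pchar k])
    (alpha beta : k)
    (hab : alpha * beta != 0 \/ (alpha = 0 /\ beta = 0))
    (L : vectType k) (br : L -> L -> L) (hL : lie_algebra br)
    (e1 e2 e3 : L) (he : basis_of fullv [:: e1; e2; e3])
    (h12 : br e1 e2 = e3) (h23 : br e2 e3 = alpha *: e1)
    (h31 : br e3 e1 = beta *: e2)
    (p u s : k) (r : tensor L L)
    (hr : r = p *: (e1 ⊗ e2) - p *: (e2 ⊗ e1)
            + s *: (e1 ⊗ e3) - s *: (e3 ⊗ e1)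
            + u *: (e2 ⊗ e3) - u *: (e3 ⊗ e2)) :
  (coboundary_lie_bialgebra br (cobracket br r) r
     <-> skew_symmetric [tuple e1; e2; e3] r)
  /\ (triangular_lie_bialgebra br (cobracket br r) r
     <-> beta * s ^+ 2 + alpha * u ^+ 2 + p ^+ 2 = 0).
Proof.
have rE : r = p *: wedge e1 e2 + s *: wedge e1 e3 + u *: wedge e2 e3.
  by rewrite hr /wedge !scalerBr !addrA.
have cobound : coboundary_lie_bialgebra br (cobracket br r) r.
  apply: (coboundary_of_wedge hL); last first.
    exact: (cobracket_wedge hL he h12 h23 h31 rE (erefl _)).
  rewrite rE -[u *: _]addr0 -addrA.
  do 3!(apply: im_one_sub_tau_linear; first exact: im_one_sub_tau_wedge).
  by exists 0; rewrite linear0 subr0.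
have skew : skew_symmetric [tuple e1; e2; e3] r.
  pose K := [:: [:: 0; p; s]; [:: - p; 0; u]; [:: - s; - u; 0]].
  exists (\matrix_(i < 3, j < 3) (nth [::] K i)`_j); last first.
    move=> i j; rewrite !mxE.
    by case: i j => [[|[|[|//]]] ?] [[|[|[|//]]] ?] /=; rewrite ?oppr0 ?opprK.
  rewrite !big_ord_recl !big_ord0 !mxE /= hr.
  rewrite !(scale0r, scaleNr, add0r, addr0) !(tnth_nth 0) /=.
  by apply/matrixP=> i j; rewrite !mxE; ring.
split; first by split.
have cy := cybeE hL he h12 h23 h31 rE (erefl _).
split=> [[_] | c0]; last by split=> //; rewrite /cybe cy c0 scale0r.
rewrite /cybe cy => /eqP.
by rewrite scaler_eq0 (negPf (volume_neq0 he)) orbF => /eqP.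
Qed.
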